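(* Let $1\le q<\infty$. The inclusion $\mathcal{L}_q\subset\mathcal{L}_q(\Delta)$ holds and is strict.
   Context: $\Omega$ is the vector space of all real double sequences $x=(x_{mn})_{m,n\ge 0}$. Terms with a negative index are taken to be $0$. The difference transform of $x\in\Omega$ is $\Delta x=((\Delta x)_{mn})$ with $(\Delta x)_{mn}=x_{mn}-x_{m,n-1}-x_{m-1,n}+x_{m-1,n-1}$. $\mathcal{L}_q=\{x\in\Omega:\sum_{m,n}|x_{mn}|^q<\infty\}$ and $\mathcal{L}_q(\Delta)=\{x\in\Omega:\Delta x\in\mathcal{L}_q\}$. *)

(* Defs.v *)
From HB Require Import structures.
From mathcomp Require Import all_boot all_order all_algebra.
From mathcomp Require Import all_classical all_reals all_analysis.
Set Implicit Arguments.
Unset Strict Implicit.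
Unset Printing Implicit Defensive.
Import Order.TTheory GRing.Theory Num.Theory.
Local Open Scope classical_set_scope.
Local Open Scope ring_scope.

Definition dseq (R : realType) : Type := nat -> nat -> R.

(* Extension by 0 to negative indices, so that x_{m-1,n} etc. make sense at
   the boundary (truncated subtraction on nat would give x_{0,n} instead). *)
Definition dseq_ext (R : realType) (x : dseq R) (i j : int) : R :=
  match i, j with
  | Posz m, Posz n => x m n
  | _, _ => 0
  end.

Definition delta (R : realType) (x : dseq R) : dseq R := fun m n =>
  x m n - dseq_ext x m%:Z (n%:Z - 1) - dseq_ext x (m%:Z - 1) n%:Z
  + dseq_ext x (m%:Z - 1) (n%:Z - 1).

(* The terms are nonnegative, so the order of summation is immaterial and
   the double series is the unordered sum over nat * nat in \bar R. *)
Definition Lq (R : realType) (q : R) : set (dseq R) :=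
  [set x | (\esum_(p in [set: nat * nat]) (`|x p.1 p.2| `^ q)%:E < +oo)%E].

Definition LqDelta (R : realType) (q : R) : set (dseq R) :=
  [set x | Lq q (delta x)].

(* Main.v *)
Require Import Defs.
From HB Require Import structures.
From mathcomp Require Import all_boot all_order all_algebra.
From mathcomp Require Import all_classical all_reals all_analysis zify.
Set Implicit Arguments.
Unset Strict Implicit.
Unset Printing Implicit Defensive.
Import Order.TTheory GRing.Theory Num.Theory.
Local Open Scope classical_set_scope.
Local Open Scope ring_scope.

(** The difference transform is a signed sum of four translates of [x], so the
    inclusion only asks that [Lq q] be stable under translation, opposite and
    sum.  Translation moves the terms of the series injectively and fills the
    vacated places with zeros, which leaves its value unchanged
    ([Lq_translate]); sums of sequences are controlled by the pointwise bound
    |a + b|^q <= 2^q (|a|^q + |b|^q) ([powR_normD_le]).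

    The inclusion is strict because the constant sequence 1 has divergent
    series, while its difference transform is the indicator of (0, 0): the
    telescoping cancels everything except the contribution of the zeros at
    negative indices. *)

Lemma esumZl_le (R : realType) (T : choiceType) (c : R) (I : set T)
    (a : T -> \bar R) : 0 <= c -> (forall i, I i -> 0 <= a i)%E ->
  (\esum_(i in I) (c%:E * a i) <= c%:E * \esum_(i in I) a i)%E.
Proof.
move=> c0 a0; rewrite ge_ereal_sup => //= _ [X [finX XI]] <-.
have -> : (\sum_(i \in X) (c%:E * a i) = c%:E * \sum_(i \in X) a i)%E.
  rewrite !fsbig_finite//= big_seq [in RHS]big_seq ge0_sume_distrr// => i.
  by rewrite in_fset_set// inE => /XI; exact: a0.
by rewrite lee_wpmul2l//; apply: esum_ge; exists X.
Qed.

(** Since |a + b| <= 2 max(|a|, |b|), the term of the larger of a and b already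
    suffices on the right. *)
Lemma powR_normD_le (R : realType) (q a b : R) : 0 <= q ->
  `|a + b| `^ q <= 2 `^ q * (`|a| `^ q + `|b| `^ q).
Proof.
move=> q0; wlog ab : a b / `|a| <= `|b|.
  move=> H; have [/H//|/ltW/H] := leP `|a| `|b|.
  by rewrite addrC [in X in _ <= X]addrC.
apply: (@le_trans _ _ ((2 * `|b|) `^ q)).
  apply: ge0_ler_powR; rewrite ?nnegrE ?mulr_ge0//.
  by rewrite mulr_natl mulr2n (le_trans (ler_normD _ _))// lerD2r.
by rewrite powRM// ler_wpM2l ?powR_ge0// lerDr powR_ge0.
Qed.

Lemma LqN (R : realType) (q : R) (x : dseq R) :
  Lq q x -> Lq q (fun m n => - x m n).
Proof. by rewrite /Lq /=; under eq_esum do rewrite -normrN. Qed.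

Lemma LqD (R : realType) (q : R) (x y : dseq R) :
  0 <= q -> Lq q x -> Lq q y -> Lq q (fun m n => x m n + y m n).
Proof.
move=> q0 xq yq; rewrite /Lq /=.
pose s p := ((`|x p.1 p.2| `^ q)%:E + (`|y p.1 p.2| `^ q)%:E)%E.
apply: (@le_lt_trans _ _ (\esum_(p in setT) ((2 `^ q)%:E * s p))%E).
  apply: le_esum => p _; rewrite /s -EFinD -EFinM lee_fin.
  exact: powR_normD_le.
apply: (le_lt_trans (esumZl_le _ _)); first exact: powR_ge0.
  by move=> p _; rewrite adde_ge0// lee_fin powR_ge0.
rewrite /s esumD => [|p _|p _]; rewrite ?lee_fin ?powR_ge0//.
by apply: lte_mul_pinfty; rewrite ?lee_fin ?powR_ge0// lte_add_pinfty.
Qed.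

(** Values at negative indices come from [dseq_ext], so that the four terms of
    [delta] are instances of it, boundary included. *)
Definition translate (R : realType) (a b : nat) (x : dseq R) : dseq R :=
  fun m n => dseq_ext x (m%:Z - a%:Z) (n%:Z - b%:Z).

Lemma translateE (R : realType) (a b m n : nat) (x : dseq R) :
  translate a b x m n =
  if (a <= m)%N && (b <= n)%N then x (m - a)%N (n - b)%N else 0.
Proof.
rewrite /translate; have [am|am] := leqP a m; last first.
  by have -> : m%:Z - a%:Z = Negz (a - m).-1 by lia.
have [bn|bn] := leqP b n; first by rewrite !subzn.
have -> : n%:Z - b%:Z = Negz (b - n).-1 by lia.
by rewrite subzn.
Qed.

(** Restricted to the range of (m, n) |-> (m + a, n + b) the translated series
    is a reindexing of the original one; off that range its terms vanish, which
    for |0|^q uses q <> 0. *)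
Lemma Lq_translate (R : realType) (q : R) (a b : nat) (x : dseq R) :
  0 < q -> Lq q x -> Lq q (translate a b x).
Proof.
move=> q0; rewrite /Lq /=.
pose e (p : nat * nat) := ((p.1 + a)%N, (p.2 + b)%N).
have e_inj : set_inj setT e.
  by move=> [m n] [m' n'] _ _ [/addIn -> /addIn ->].
congr (_ < _)%E.
transitivity (\esum_(p in range e) (`|translate a b x p.1 p.2| `^ q)%:E)%E.
  rewrite esum_image//; apply: eq_esum => -[m n] _ /=.
  by rewrite translateE !leq_addl/= !addnK.
rewrite [LHS]esum_mkcond; apply: eq_esum => -[m n] _.
case: ifPn => //; rewrite notin_setE /= => mn; rewrite translateE.
case: ifPn => [/andP[am bn]|_]; last by rewrite normr0 powR0// gt_eqF.
by case: mn; exists ((m - a)%N, (n - b)%N); rewrite // /e /= !subnK.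
Qed.

Lemma delta_translate (R : realType) (x : dseq R) : delta x =
  fun m n => x m n - translate 0 1 x m n - translate 1 0 x m n
             + translate 1 1 x m n.
Proof. by apply/funext => m; apply/funext => n; rewrite /delta/translate !subr0. Qed.

Lemma delta_const (R : realType) (c : R) (m n : nat) :
  delta (fun _ _ => c) m n = if (m, n) == (0, 0)%N then c else 0.
Proof.
rewrite delta_translate !translateE.
by case: m n => [|m] [|n] /=; rewrite ?subr0 ?addr0 ?subrr ?sub0r ?addNr.
Qed.

Theorem theorem2p8 (R : realType) (q : R) (hq : 1 <= q) :
  Lq q `<` LqDelta q.
Proof.
have q_gt0 : 0 < q by exact: lt_le_trans hq.
have q_ge0 := ltW q_gt0.
split=> [x xq|/(_ (fun _ _ => 1))].
  rewrite /LqDelta /= delta_translate.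
  apply: LqD => //; last exact: Lq_translate.
  apply: LqD => //; last by apply: LqN; exact: Lq_translate.
  by apply: LqD => //; apply: LqN; exact: Lq_translate.
have delta1_q : LqDelta q (fun _ _ => 1 : R).
  rewrite /LqDelta /Lq /=.
  (* Only the term at (0, 0) survives, so the series sums to 1. *)
  have -> : (\esum_(p in [set: nat * nat])
      (`|delta (fun _ _ => 1 : R) p.1 p.2| `^ q)%:E =
      \esum_(p in [set (0, 0)%N]) 1%E)%E.
    rewrite [RHS]esum_mkcond; apply: eq_esum => -[m n] _; rewrite delta_const.
    rewrite in_set1 /=; case: ifPn => _; first by rewrite normr1 powR1.
    by rewrite normr0 powR0// gt_eqF.
  by rewrite esum_set1// ltry.
move=> /(_ delta1_q).
rewrite /Lq /=.
suff -> : (\esum_(p in [set: nat * nat]) (`|1 : R| `^ q)%:E = +oo)%E.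
  by rewrite ltxx.
(* A sum of ones over an infinite set, the ones being Dirac masses of setT. *)
rewrite -(infinite_card_dirac R infinite_prod_nat); apply: eq_esum => p _.
by rewrite normr1 powR1 diracT.
Qed.
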